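(* The following statements are equivalent for a domain $R$. (1) $R$ is a generalized Krull domain. (2) $R$ is a $t$-potent essential domain of $t$-dimension one. (3) $R$ is a $t$-potent P$v$MD of $t$-dimension one. (4) $R$ is a completely integrally closed $t$-super potent domain. (5) $R$ is a $t$-super potent domain of $t$-dimension one.
   Context: For a domain $R$ with quotient field $K$ and a nonzero fractional ideal $I$ of $R$, put $I^{-1}=\{x\in K: xI\subseteq R\}$, $I^v=(I^{-1})^{-1}$, and $I^t=\bigcup J^v$, the union over all nonzero finitely generated subideals $J$ of $I$. A $t$-ideal is a nonzero ideal $I$ with $I^t=I$. A maximal $t$-ideal is an ideal of $R$ maximal among the proper $t$-ideals. A nonzero ideal $I$ is $t$-invertible if $(II^{-1})^t=R$. A nonzero finitely generated ideal $I$ of $R$ is $t$-rigid if it is contained in exactly one maximal $t$-ideal, and $t$-super rigid if, in addition, every finitely generated ideal $J\supseteq I$ of $R$ is $t$-invertible. $R$ is $t$-potent (respectively $t$-super potent) if each maximal $t$-ideal of $R$ contains a $t$-rigid (respectively $t$-super rigid) ideal. $R$ has $t$-dimension one if each maximal $t$-ideal of $R$ has height one. A set $\mathcal P$ of prime ideals of $R$ is a defining family if $R=\bigcap_{P\in\mathcal P}R_P$; it has finite character if each nonzero element of $R$ lies in at most finitely many elements of $\mathcal P$. A prime $P$ is essential if $R_P$ is a valuation domain. $R$ is an essential domain if it possesses a defining family of essential primes, and a generalized Krull domain if it possesses a finite character defining family of height-one essential primes. $R$ is a Prüfer $v$-multiplication domain (P$v$MD) if each nonzero finitely generated ideal of $R$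 is $t$-invertible. $R$ is completely integrally closed if, whenever $0\ne a\in R$ and $u\in K$ satisfy $au^n\in R$ for each positive integer $n$, then $u\in R$. *)

(* Defs.v *)
From mathcomp Require Import all_boot all_algebra.
From mathcomp Require Import boolp classical_sets cardinality.

Set Implicit Arguments.
Unset Strict Implicit.
Unset Printing Implicit Defensive.

Import GRing.Theory.

Local Open Scope ring_scope.
Local Open Scope classical_set_scope.

(* The domain [R] is identified with its image [base_ring R] in its quotient
   field [{fraction R}]; ideals of [R], fractional ideals and localizations of
   [R] are all represented as subsets of [{fraction R}]. *)

Notation embed := (@FracField.tofrac _).

Definition base_ring (R : idomainType) : set {fraction R} :=
  [set embed r | r in [set: R]].
Arguments base_ring R : clear implicits.

Section Ideals.
Variable R : idomainType.
Local Notation K := {fraction R}.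
Implicit Types (I J P M V S : set K) (F : set (set K)).

Definition submodule I : Prop :=
  [/\ I 0,
      (forall x y, I x -> I y -> I (x + y)) &
      (forall (r : R) x, I x -> I (embed r * x))].

Definition is_ideal I : Prop := submodule I /\ I `<=` base_ring R.

Definition nonzero I : Prop := exists2 x, I x & x != 0.

Definition span S : set K :=
  [set x | exists n (r : 'I_n -> R) (s : 'I_n -> K),
     (forall i, S (s i)) /\ x = \sum_(i < n) embed (r i) * s i].

Definition fin_generated I : Prop := exists s : seq K, I = span [set` s].

Definition idealM I J : set K := span [set a * b | a in I & b in J].

Definition idealV I : set K := [set x | forall a, I a -> base_ring R (x * a)].

Definition v_closure I : set K := idealV (idealV I).

Definition t_closure I : set K :=
  \bigcup_(J in [set J | [/\ nonzero J, fin_generated J & J `<=` I]])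
    v_closure J.

Definition t_ideal I : Prop := [/\ is_ideal I, nonzero I & t_closure I = I].

Definition proper_t_ideal I : Prop := t_ideal I /\ I <> base_ring R.

Definition maximal_t_ideal M : Prop :=
  proper_t_ideal M /\ forall I, proper_t_ideal I -> M `<=` I -> I = M.

Definition t_invertible I : Prop := t_closure (idealM I (idealV I)) = base_ring R.

Definition t_rigid I : Prop :=
  [/\ is_ideal I, nonzero I, fin_generated I &
      exists! M, maximal_t_ideal M /\ I `<=` M].

Definition t_super_rigid I : Prop :=
  t_rigid I /\
  forall J, is_ideal J -> fin_generated J -> I `<=` J -> t_invertible J.

Definition is_prime P : Prop :=
  [/\ is_ideal P, P <> base_ring R &
      forall a b : R, P (embed (a * b)) -> P (embed a) \/ P (embed b)].

(* [c 0 `<` c 1 `<` ... `<` c n = P], a strict chain of primes of length [n];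
   the values of [c] beyond [n] are irrelevant. *)
Definition prime_chain (n : nat) P (c : nat -> set K) : Prop :=
  [/\ (forall i, (i <= n)%N -> is_prime (c i)),
      (forall i, (i < n)%N -> c i `<` c i.+1) & c n = P].

Definition has_height P (n : nat) : Prop :=
  (exists c, prime_chain n P c) /\
  (forall m c, prime_chain m P c -> (m <= n)%N).

Definition localization P : set K :=
  [set x | exists a s : R, ~ P (embed s) /\ x = embed a / embed s].

(* Valuation domain, for a subring [V] of [K] with quotient field [K]. *)
Definition valuation_subring V : Prop := forall x : K, x != 0 -> V x \/ V x^-1.

Definition essential_prime P : Prop :=
  is_prime P /\ valuation_subring (localization P).

(* The intersection is taken inside [K]: that of the empty family is [K]. *)
Definition defining_family F : Prop :=
  F `<=` is_prime /\ base_ring R = \bigcap_(P in F) localization P.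

Definition finite_character F : Prop :=
  forall a : R, a != 0 -> finite_set [set P | F P /\ P (embed a)].

End Ideals.

Section Domains.
Variable R : idomainType.
Local Notation K := {fraction R}.

Definition t_potent : Prop :=
  forall M : set K, maximal_t_ideal M -> exists2 I, t_rigid I & I `<=` M.

Definition t_super_potent : Prop :=
  forall M : set K, maximal_t_ideal M -> exists2 I, t_super_rigid I & I `<=` M.

Definition t_dimension_one : Prop :=
  forall M : set K, maximal_t_ideal M -> has_height M 1.

Definition essential_domain : Prop :=
  exists F : set (set K), defining_family F /\ F `<=` @essential_prime R.

Definition generalized_Krull_domain : Prop :=
  exists F : set (set K),
    [/\ defining_family F, finite_character F &
        forall P, F P -> has_height P 1 /\ essential_prime P].

Definition PvMD : Prop :=
  forall I : set K, is_ideal I -> nonzero I -> fin_generated I -> t_invertible I.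

Definition completely_integrally_closed : Prop :=
  forall (a : R) (u : K), a != 0 ->
    (forall n : nat, (0 < n)%N -> base_ring R (embed a * u ^+ n)) ->
    base_ring R u.

End Domains.

Arguments t_potent R : clear implicits.
Arguments t_super_potent R : clear implicits.
Arguments t_dimension_one R : clear implicits.
Arguments essential_domain R : clear implicits.
Arguments generalized_Krull_domain R : clear implicits.
Arguments PvMD R : clear implicits.
Arguments completely_integrally_closed R : clear implicits.

(* Main.v *)
From mathcomp Require Import all_boot all_algebra.
From mathcomp Require Import boolp classical_sets cardinality ring.
Require Import Defs.

(** Write t-max for maximal t-ideal.  Each nonzero proper t-ideal lies in a
t-max (Zorn), t-maxes are prime, and [R] is the intersection of its
localizations at them ([t_ideal_sub_maximal], [maximal_t_ideal_prime],
[base_ring_bigcap]).  A finite family is t-invertible exactly when it is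
invertible at each t-max [M]: some [z] carrying the family into [R] carries one
of its members [g] outside [M] ([t_invertible_at], [t_invertible_local]).

(1) => (2): a proper t-ideal lies in a member of the defining family, since
otherwise finitely many of its elements avoid all members and have v-closure
[R]; so the family is the set of all t-maxes.  (2) => (3): a rigid ideal in [M]
must lie in an essential prime of the family, which by height one is [M]; then
all [R_M] are valuation domains and finitely generated ideals are locally
principal.  (3) => (4): conversely every [R_M] is a valuation domain, of rank
one, hence completely integrally closed, and [R] is their intersection.

The remaining implications rest on one construction.  Let [I] be a t-super
rigid ideal inside [M], generated at [M] by [c], with [z * I] inside [R] and
[z * c] outside [M].  Since [I] lies in no other t-max, [z] belongs to [R_N] for
all t-maxes [N] other than [M].  Hence, as soon as no nonzero element of [R] is
divisible at [M] by all powers of [c], each nonzero [x] of [R] has a multiple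
[x * z ^+ i], again in [R], which is not divisible by [c] at [M]
([super_rigid_reduced]).  As the ideal generated by [I] and this element is
again t-invertible, the element divides [c] at [M]
([super_rigid_reduced_unit]).  That no nonzero [x] is divisible by all powers of
[c] follows from complete integral closure, because [x * z ^+ n] would lie in
[R] for all [n]; and it follows from height one, because the elements divisible
by all powers of [c] form a prime ideal omitting [c].

(4) => (5): by the reduction above, a nonzero prime inside [M] contains every
t-super rigid ideal inside [M]; these cover [M].  (5) => (1): the reduction
makes [R_M] a valuation domain ([super_rigid_essential]).  For finite character,
it produces for each t-max [M] containing [a] an element outside [M] that lies
in all the other t-maxes containing [a]; as the t-operation is determined by
finite subsets, finitely many of these elements together with [a] already have
v-closure [R], which leaves only finitely many [M]. *)

Set Implicit Arguments.
Unset Strict Implicit.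
Unset Printing Implicit Defensive.

Import GRing.Theory.

Local Open Scope ring_scope.
Local Open Scope classical_set_scope.

(** * Submodules of the quotient field *)

Section Submodules.
Variable R : idomainType.
Local Notation K := {fraction R}.
Local Notation A := (base_ring R).
Implicit Types (x y z : K) (I J S T V : set K).

Lemma base_ring_embed (r : R) : A (embed r).
Proof. by exists r. Qed.

Lemma base_ring0 : A 0.
Proof. by exists 0; rewrite ?tofrac0. Qed.

Lemma base_ring1 : A 1.
Proof. by exists 1; rewrite ?tofrac1. Qed.

Lemma base_ringM x y : A x -> A y -> A (x * y).
Proof. by move=> [a _ <-] [b _ <-]; exists (a * b); rewrite ?tofracM. Qed.

Lemma base_ringX x n : A x -> A (x ^+ n).
Proof.
move=> Ax; elim: n => [|n IHn]; first exact: base_ring1.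
by rewrite exprS; apply: base_ringM.
Qed.

Lemma submodule_base_ring : submodule A.
Proof.
split; first exact: base_ring0.
  by move=> x y [a _ <-] [b _ <-]; exists (a + b); rewrite ?tofracD.
by move=> r x; apply/base_ringM/base_ring_embed.
Qed.

Lemma submoduleM I x y : submodule I -> A x -> I y -> I (x * y).
Proof. by move=> [_ _ IM] [r _ <-]; apply: IM. Qed.

Lemma submodule_sum I n (F : 'I_n -> K) :
  submodule I -> (forall i, I (F i)) -> I (\sum_(i < n) F i).
Proof.
move=> [I0 ID _] IF.
by elim/big_ind: _ => // x y; apply: ID.
Qed.

Lemma sub_span S : S `<=` span S.
Proof.
move=> x Sx; exists 1%N, (fun=> 1), (fun=> x); split=> //.
by rewrite big_ord1 tofrac1 mul1r.
Qed.

Lemma span_min S I : submodule I -> S `<=` I -> span S `<=` I.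
Proof.
move=> sI SI x [n [r [s [Ss ->]]]]; apply: submodule_sum => // i.
by case: (sI) => _ _; apply; apply/SI/Ss.
Qed.

Lemma submodule_span S : submodule (span S).
Proof.
split.
- exists 0%N, (fun=> 0), (fun=> 0); split; first by case.
  by rewrite big_ord0.
- move=> x y [m [r [s [Ss ->]]]] [n [q [t [St ->]]]].
  exists (m + n)%N.
  exists (fun i => match split i with inl j => r j | inr j => q j end).
  exists (fun i => match split i with inl j => s j | inr j => t j end).
  split; first by move=> i; case: (split i).
  rewrite big_split_ord /=; congr (_ + _); apply: eq_bigr => i _.
    by rewrite (unsplitK (inl i : 'I_m + 'I_n)).
  by rewrite (unsplitK (inr i : 'I_m + 'I_n)).
- move=> a x [n [r [s [Ss ->]]]].
  exists n, (fun i => a * r i), s; split=> //.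
  by rewrite mulr_sumr; apply: eq_bigr => i _; rewrite tofracM mulrA.
Qed.

Lemma span_mono S T : S `<=` T -> span S `<=` span T.
Proof.
by move=> ST; apply: span_min (submodule_span T) _ => x /ST; apply: sub_span.
Qed.

Lemma span_finite_support S x :
  span S x -> exists2 s : seq K, [set` s] `<=` S & span [set` s] x.
Proof.
move=> [n [r [f [Sf ->]]]]; exists [seq f i | i <- enum 'I_n].
  by move=> _ /mapP[i _ ->].
exists n, r, f; split=> // i.
by apply/mapP; exists i; rewrite ?mem_enum.
Qed.

(** A monotone operator which is algebraic (each value is reached from finitely
many elements) is also algebraic on finite families: the finitely many finite
witnesses are pooled. It is used for [span] and for the v-closure. *)
Lemma gather_finite (cl : set K -> set K) S T :
    (forall X Y, X `<=` Y -> cl X `<=` cl Y) ->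
    (forall x, T x -> exists2 s : seq K, [set` s] `<=` S & cl [set` s] x) ->
  forall t : seq K, [set` t] `<=` T ->
    exists2 s : seq K, [set` s] `<=` S & [set` t] `<=` cl [set` s].
Proof.
move=> cl_mono clT; elim=> [|x t IHt] tT; first by exists [::].
have [y ty|s1 s1S ts1] := IHt; first by apply: tT; rewrite /= inE ty orbT.
have [|s2 s2S xs2] := clT x; first by apply: tT; rewrite /= mem_head.
exists (s1 ++ s2).
  by move=> y; rewrite /= mem_cat => /orP[/s1S|/s2S].
move=> y /=; rewrite inE => /predU1P[->|/ts1].
  by apply: cl_mono xs2 => u /= su; rewrite mem_cat su orbT.
by apply: cl_mono => u /= su; rewrite mem_cat su.
Qed.

Lemma cons_sub I (y : K) (s : seq K) :
  I y -> [set` s] `<=` I -> [set` y :: s] `<=` I.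
Proof. by move=> Iy sI x /=; rewrite inE => /predU1P[->|/sI]. Qed.

(** * The v- and t-operations *)

Lemma submodule_idealV S : submodule (idealV S).
Proof.
split.
- by move=> a _; rewrite mul0r; apply: base_ring0.
- move=> x y Vx Vy a Sa; rewrite mulrDl.
  by have [_ + _] := submodule_base_ring; apply; [apply: Vx|apply: Vy].
- move=> r x Vx a Sa; rewrite -mulrA.
  by apply: base_ringM; [apply: base_ring_embed|apply: Vx].
Qed.

Lemma idealV_anti S T : S `<=` T -> idealV T `<=` idealV S.
Proof. by move=> ST x Vx a /ST; apply: Vx. Qed.

Lemma idealV_span S : idealV (span S) = idealV S.
Proof.
apply/seteqP; split; first exact: (idealV_anti (@sub_span S)).
move=> x Vx a [n [r [s [Ss ->]]]]; rewrite mulr_sumr.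
apply: submodule_sum submodule_base_ring _ => i; rewrite mulrCA.
by apply: base_ringM; [apply: base_ring_embed|apply/Vx/Ss].
Qed.

Lemma sub_v_closure S : S `<=` v_closure S.
Proof. by move=> x Sx a Va; rewrite mulrC; apply: Va. Qed.

Lemma v_closure_mono S T : S `<=` T -> v_closure S `<=` v_closure T.
Proof. by move=> ST; apply/idealV_anti/idealV_anti. Qed.

Lemma v_closure_trans S T : S `<=` v_closure T -> v_closure S `<=` v_closure T.
Proof. by move=> ST x vSx a Va; apply: vSx => b /ST; rewrite mulrC; apply. Qed.

Lemma v_closure_span S : v_closure (span S) = v_closure S.
Proof. by rewrite /v_closure idealV_span. Qed.

Lemma submodule_v_closure S : submodule (v_closure S).
Proof. exact: submodule_idealV. Qed.

Lemma v_closure_base S : S `<=` A -> v_closure S `<=` A.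
Proof.
move=> SA x /(_ 1); rewrite mulr1; apply=> a /SA Aa.
by rewrite mul1r.
Qed.

(** The quantification over finite families instead of nonzero finitely
generated submodules is harmless, since a nonzero element of [I] can be added
to any family; it makes the directedness of the union a matter of
concatenating lists. *)
Lemma t_closureP I x : submodule I -> nonzero I ->
  t_closure I x <->
  exists2 s : seq K, [set` s] `<=` I & v_closure [set` s] x.
Proof.
move=> sI [y Iy y0]; split=> [[J [_ [s ->] sJ]]|[s sI' vs]].
  rewrite v_closure_span => vs; exists s => // z sz.
  by apply/sJ/sub_span.
have ysI := cons_sub Iy sI'.
exists (span [set` y :: s]); last first.
  rewrite v_closure_span; apply: v_closure_mono vs => z /= sz.
  by rewrite inE sz orbT.
split; last exact: span_min.
  by exists y => //; apply: sub_span; rewrite /= mem_head.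
by exists (y :: s).
Qed.

Definition t_closed I : Prop :=
  forall s : seq K, [set` s] `<=` I -> v_closure [set` s] `<=` I.

Lemma sub_t_closure I : submodule I -> nonzero I -> I `<=` t_closure I.
Proof.
move=> sI nI x Ix; apply/t_closureP => //; exists [:: x].
  by move=> y; rewrite /= inE => /eqP->.
by apply: sub_v_closure; rewrite /= mem_head.
Qed.

Lemma t_idealP I : t_ideal I <-> [/\ is_ideal I, nonzero I & t_closed I].
Proof.
split=> -[[sI IA] nI tI]; split=> //.
  by move=> s sI' x vs; rewrite -tI; apply/t_closureP => //; exists s.
apply/seteqP; split; last exact: sub_t_closure.
by move=> x /t_closureP[//|//|s sI' /tI]; apply.
Qed.

(** Idempotence of the t-operation: a finite part of the t-closure lies in the
v-closure of a single finite subset of [I]. *)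
Lemma t_closure_t_ideal I : is_ideal I -> nonzero I -> t_ideal (t_closure I).
Proof.
move=> [sI IA] nI; apply/t_idealP; split.
- split; last first.
    move=> x /t_closureP[//|//|s sI' vs].
    by apply: v_closure_base vs => y /sI'/IA.
  split.
  + by apply: sub_t_closure => //; case: sI.
  + move=> x y /t_closureP[//|//|s sI' vs] /t_closureP[//|//|t tI vt].
    apply/t_closureP => //; exists (s ++ t).
      by move=> z; rewrite /= mem_cat => /orP[/sI'|/tI].
    have [_ vD _] := submodule_v_closure [set` s ++ t].
    apply: vD; [apply: v_closure_mono vs|apply: v_closure_mono vt];
      by move=> z /= z_in; rewrite mem_cat z_in ?orbT.
  + move=> r x /t_closureP[//|//|s sI' vs].
    apply/t_closureP => //; exists s => //.
    by have [_ _] := submodule_v_closure [set` s]; apply.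
- by case: nI (nI) => x Ix x0 nI; exists x => //; apply: sub_t_closure.
- move=> s st; have [x|t tI sv] := gather_finite (S := I) (@v_closure_mono) _ st.
    by move/(t_closureP _ sI nI).
  move=> x /(v_closure_trans sv) vt.
  by apply/t_closureP => //; exists t.
Qed.

End Submodules.

(** * Primes, localizations and maximal t-ideals *)

Section MaximalTIdeals.
Variable R : idomainType.
Local Notation K := {fraction R}.
Local Notation A := (base_ring R).
Implicit Types (x y z u : K) (I J M N P S : set K).

Lemma fraction_denom x : exists a s : R, s != 0 /\ embed s * x = embed a.
Proof.
elim/quotW: x => r; exists (\n_r), (\d_r); split; first exact: denom_ratioP.
unlock FracField.tofrac; rewrite -[LHS]FracField.pi_mul; apply/eqmodP => /=.
rewrite FracField.equivfE /FracField.mulf /= !numden_Ratio;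
  by rewrite ?mulf_neq0 ?oner_neq0 ?denom_ratioP // mul1r mulr1 mulrC.
Qed.

Lemma ideal_eq_base I : is_ideal I -> I 1 -> I = A.
Proof.
move=> [sI IA] I1; apply/seteqP; split=> // x Ax.
by rewrite -[x]mulr1; apply: submoduleM.
Qed.

Lemma proper_idealP I : is_ideal I -> I <> A <-> ~ I 1.
Proof.
move=> iI; split=> [nIA /(ideal_eq_base iI)//|nI1 IA].
by apply: nI1; rewrite IA; apply: base_ring1.
Qed.

Lemma ideal_mulr I x y : is_ideal I -> I x -> A y -> I (x * y).
Proof. by move=> [sI _] Ix Ay; rewrite mulrC; apply: submoduleM. Qed.

Lemma prime_mul P x y : is_prime P -> A x -> A y -> P (x * y) -> P x \/ P y.
Proof. by move=> [_ _ pP] [a _ <-] [b _ <-]; rewrite -tofracM; apply: pP. Qed.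

Lemma prime_neq1 P : is_prime P -> ~ P 1.
Proof. by move=> [iP nPA _]; apply/proper_idealP. Qed.

Lemma prime_exp P x n : is_prime P -> A x -> P (x ^+ n) -> P x.
Proof.
move=> pP Ax; elim: n => [|n IHn]; first by move/(prime_neq1 pP).
by rewrite exprS => /(prime_mul pP Ax)[|//|//]; apply: base_ringX.
Qed.

Lemma prime_notin_mul P x y :
  is_prime P -> A x -> A y -> ~ P x -> ~ P y -> ~ P (x * y).
Proof. by move=> pP Ax Ay nPx nPy /(prime_mul pP Ax Ay)[]. Qed.

Lemma prime_notin_neq0 P x : is_prime P -> ~ P x -> x != 0.
Proof. by move=> [[[P0 _ _] _] _ _]; apply: contra_notN => /eqP->. Qed.

Lemma prime_zero : is_prime [set 0 : K].
Proof.
split.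
- split; last by move=> _ ->; apply: base_ring0.
  split=> // [x y -> ->|r x ->]; first by rewrite addr0.
  by rewrite mulr0.
- move=> E; have := base_ring1 R; rewrite -E => /eqP.
  by rewrite oner_eq0.
- move=> a b /eqP; rewrite tofracM mulf_eq0.
  by case/orP=> /eqP; [left|right].
Qed.

(** With denominators cleared, later verifications become ring identities. *)
Lemma localizationP P x : is_prime P ->
  localization P x <-> exists s, [/\ A s, ~ P s & A (s * x)].
Proof.
move=> pP; split=> [[a [s [nPs ->]]]|[_ [[s _ <-] nPs [a _ asx]]]].
  have s0 := prime_notin_neq0 pP nPs.
  exists (embed s); split=> //; first exact: base_ring_embed.
  by rewrite mulrC divfK //; apply: base_ring_embed.
exists a, s; split=> //; apply: (canRL (mulfK _)) => //.
  exact: prime_notin_neq0 nPs.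
by rewrite mulrC.
Qed.

Lemma base_sub_localization P : is_prime P -> A `<=` localization P.
Proof.
move=> pP x Ax; apply/localizationP => //; exists 1.
by split; [apply: base_ring1|apply: prime_neq1|rewrite mul1r].
Qed.

Lemma localizationM P x y : is_prime P ->
  localization P x -> localization P y -> localization P (x * y).
Proof.
move=> pP /(localizationP _ pP)[s [As nPs Asx]].
move=> /(localizationP _ pP)[t [At nPt Aty]].
apply/localizationP => //; exists (s * t); split; first exact: base_ringM.
  exact: prime_notin_mul.
by rewrite mulrACA; apply: base_ringM.
Qed.

Lemma localization_cancel P x y : is_prime P ->
  A y -> ~ P y -> localization P (y * x) -> localization P x.
Proof.
move=> pP Ay nPy /(localizationP _ pP)[s [As nPs Asx]].
apply/localizationP => //; exists (s * y).
by rewrite -mulrA; split=> //; [apply: base_ringM|apply: prime_notin_mul].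
Qed.

Lemma localizationX P x n : is_prime P ->
  localization P x -> localization P (x ^+ n).
Proof.
move=> pP Px; elim: n => [|n IHn].
  exact/base_sub_localization/base_ring1.
by rewrite exprS; apply: localizationM.
Qed.

(** Properness means omitting [1], and the axioms of a t-ideal involve finitely
many elements at a time; any finite part of the union of a chain lies in one
member, so Zorn's lemma applies. *)
Lemma t_ideal_sub_maximal I : proper_t_ideal I ->
  exists2 M, maximal_t_ideal M & I `<=` M.
Proof.
move=> ptI.
have [|B [ptB maxB]] := @Zorn_bigcup K (fun B => proper_t_ideal (I `|` B)).
  move=> F Fpt Ftot; set U := I `|` _.
  have finU (s : seq K) : [set` s] `<=` U ->
      exists Y, [/\ proper_t_ideal Y, Y `<=` U & [set` s] `<=` Y].
    move=> sU; suff [Y [YF sY]] : exists Y,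
        (Y = I \/ exists2 X, F X & Y = I `|` X) /\ [set` s] `<=` Y.
      exists Y; split=> //.
        by case: YF => [->//|[X FX ->]]; apply: Fpt.
      case: YF => [->|[X FX ->]]; first exact: subsetUl.
      by apply: setUS => x Xx; exists X.
    elim: s sU => [|x s IHs] sU; first by exists I; split=> //; left.
    have [y ys|Y [YF sY]] := IHs; first by apply: sU; rewrite /= inE ys orbT.
    have [Ix|[X FX Xx]] : I x \/ exists2 X, F X & X x.
      by apply: (sU x); rewrite /= mem_head.
      exists Y; split=> //; apply: cons_sub => //.
      by case: YF => [->//|[X _ ->]]; left.
    case: YF => [EY|[X' FX' EY]].
      exists (I `|` X); split; first by right; exists X.
      by apply: cons_sub; [right|rewrite -EY => y /sY; left].
    have [XX'|X'X] := Ftot _ _ FX FX'.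
      exists Y; split; first by right; exists X'.
      by apply: cons_sub => //; rewrite EY; right; apply: XX'.
    exists (I `|` X); split; first by right; exists X.
    apply: cons_sub; first by right.
    by move=> y /sY; rewrite EY => -[]; [left|move/X'X; right].
  have [[[sI IA] nI _] _] := ptI.
  have iU : is_ideal U.
    split; [split|].
    - by left; case: sI.
    - move=> x y Ux Uy; have [z|Y [[[[[_ YD _] _] _ _] _] YU sY]] := finU [:: x; y].
        by rewrite /= !inE => /orP[]/eqP->.
      by apply/YU/YD; apply: sY; rewrite /= !inE eqxx ?orbT.
    - move=> r x Ux; have [z|Y [[[[[_ _ YM] _] _ _] _] YU sY]] := finU [:: x].
        by rewrite /= !inE => /eqP->.
      by apply/YU/YM/sY; rewrite /= inE.
    - move=> x Ux; have [z|Y [[[[_ YA] _ _] _] YU sY]] := finU [:: x].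
        by rewrite /= !inE => /eqP->.
      by apply/YA/sY; rewrite /= inE.
  split; last first.
    apply/proper_idealP => // U1; have [z|Y [[[iY _ _] nY] _ sY]] := finU [:: 1].
      by rewrite /= !inE => /eqP->.
    by move/proper_idealP: nY; apply=> //; apply: sY; rewrite /= inE.
  apply/t_idealP; split=> //; first by case: nI => x Ix x0; exists x => //; left.
  move=> s /finU[Y [[/t_idealP[_ _ tY] _] YU sY]].
  by apply: subset_trans YU; apply: tY.
exists (I `|` B); last exact: subsetUl.
split=> // J ptJ IBJ.
have IJ : I `|` J = J by apply/setUidr => x Ix; apply: IBJ; left.
apply/seteqP; split=> // x Jx; right; apply: contrapT => nBx.
apply: (maxB J); last by rewrite IJ.
by split=> [y By|/(_ x Jx)//]; apply: IBJ; right.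
Qed.

Lemma maximal_t_ideal_ideal M : maximal_t_ideal M -> is_ideal M.
Proof. by case=> -[[]]. Qed.

Lemma maximal_t_ideal_nonzero M : maximal_t_ideal M -> nonzero M.
Proof. by case=> -[[]]. Qed.

Lemma maximal_t_ideal_closed M : maximal_t_ideal M -> t_closed M.
Proof. by case=> -[/t_idealP[]]. Qed.

Lemma maximal_t_ideal_inj M N :
  maximal_t_ideal M -> maximal_t_ideal N -> M `<=` N -> M = N.
Proof. by move=> [_ maxM] [ptN _] /(maxM _ ptN). Qed.

(** If the t-closure were proper, a maximal t-ideal above it would contain
[I]. *)
Lemma t_closure_full I : is_ideal I -> nonzero I ->
  (forall M, maximal_t_ideal M -> ~ I `<=` M) -> t_closure I = A.
Proof.
move=> iI nI noM; apply: contrapT => ntI.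
have [|M maxM tM] := @t_ideal_sub_maximal (t_closure I).
  by split=> //; apply: t_closure_t_ideal.
by apply: (noM M maxM); apply: subset_trans tM; apply: sub_t_closure; case: iI.
Qed.

Lemma t_closure_sub_maximal I M : submodule I ->
  maximal_t_ideal M -> I `<=` M -> t_closure I `<=` M.
Proof.
move=> sI maxM IM x tx.
have nI : nonzero I.
  by case: tx => J [[y Jy y0] _ JI] _; exists y => //; apply: JI.
move/t_closureP: tx => -[//|//|s sI'].
by apply: maximal_t_ideal_closed maxM _ _ _; apply: subset_trans IM.
Qed.

Lemma t_closed_full I : is_ideal I -> nonzero I -> t_closed I ->
  (forall M, maximal_t_ideal M -> ~ I `<=` M) -> I = A.
Proof.
move=> iI nI tI noM; have [_ _ <-] : t_ideal I by exact/t_idealP.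
exact: t_closure_full.
Qed.

(** For [a] outside [M], the conductor of [a] into [M] is again a proper
t-ideal, so by maximality it is [M]. *)
Lemma maximal_t_ideal_prime M : maximal_t_ideal M -> is_prime M.
Proof.
move=> maxM; have iM := maximal_t_ideal_ideal maxM.
have [[[[M0 MD MM] MA] nM _] pM] := maxM.1; split=> // a b Mab.
apply: contrapT => /not_orP[nMa nMb]; apply: nMb.
set N : set K := [set x | A x /\ M (embed a * x)].
have ptN : proper_t_ideal N; last first.
  rewrite -(maxM.2 N ptN); last first.
    by move=> x Mx; split; [apply: MA|apply: MM].
  by split; [apply: base_ring_embed|rewrite -tofracM].
have iN : is_ideal N.
  split=> [|x []//]; split.
  - by split; [apply: base_ring0|rewrite mulr0].
  - move=> x y [Ax Mx] [Ay My]; split; last by rewrite mulrDr; apply: MD.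
    by have [_ + _] := submodule_base_ring R; apply.
  - move=> r x [Ax Mx]; split; first exact/base_ringM/Ax/base_ring_embed.
    by rewrite mulrCA; apply: MM.
split; last by apply/proper_idealP => // -[_]; rewrite mulr1.
apply/t_idealP; split=> //.
  case: nM => x Mx x0; exists x => //; split; first exact: MA.
  exact: MM.
move=> s sN x vs; split; first by apply: v_closure_base vs => y /sN[].
apply: (maximal_t_ideal_closed maxM (s := [seq embed a * y | y <- s])).
  by move=> _ /mapP[y /sN[_ ?] ->].
move=> z Vz; have -> : embed a * x * z = x * (embed a * z) by ring.
apply: vs => y sy; have -> : embed a * z * y = z * (embed a * y) by ring.
exact/Vz/map_f.
Qed.

(** If [x] lies in every localization, its conductor into [R] is a t-ideal
contained in no maximal t-ideal. *)
Lemma base_ring_bigcap x :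
  (forall M, maximal_t_ideal M -> localization M x) -> A x.
Proof.
move=> locx; set N : set K := [set r | A r /\ A (r * x)].
have [AD Az] : (forall y z, A y -> A z -> A (y + z)) /\ A 0.
  by have [A0 AD _] := submodule_base_ring R.
suff NA : N = A.
  have [_] : N 1 by rewrite NA; apply: base_ring1.
  by rewrite mul1r.
apply: t_closed_full.
- split=> [|y []//]; split.
  + by split; rewrite ?mul0r.
  + by move=> y z [Ay Ayx] [Az' Azx]; split; rewrite ?mulrDl; apply: AD.
  + by move=> r y [Ay Ayx]; rewrite /N /= -mulrA; split;
      apply: base_ringM => //; apply: base_ring_embed.
- have [a [s [s0 sx]]] := fraction_denom x.
  exists (embed s); last by rewrite tofrac_eq0.
  by split; rewrite ?sx; apply: base_ring_embed.
- move=> s sN r vs; split; first by apply: v_closure_base vs => y /sN[].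
  by apply: vs => y /sN[_]; rewrite mulrC.
- move=> M maxM NM; have pM := maximal_t_ideal_prime maxM.
  have /(localizationP _ pM)[s [As nMs Asx]] := locx M maxM.
  by apply/nMs/NM.
Qed.

End MaximalTIdeals.

(** * Primes of height one *)

Section HeightOne.
Variable R : idomainType.
Local Notation K := {fraction R}.
Local Notation A := (base_ring R).
Implicit Types (x y z u : K) (I J M N P S : set K).

Lemma height1_prime_eq M P : is_prime M -> has_height M 1 ->
  is_prime P -> nonzero P -> P `<=` M -> P = M.
Proof.
move=> pM [_ hM] pP nP PM; apply/seteqP; split=> //.
apply: contrapT => nMP; suff /hM : prime_chain 2 M
  (fun i => if i is i'.+1 then if i' is 0 then P else M else [set 0]) by [].
split=> //; first by case=> [|[|i]] _ //; apply: prime_zero.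
case=> [|[|//]] _ //; split.
  by move=> _ ->; case: pP => -[[]].
by case: nP => x Px /eqP x0 /(_ x Px).
Qed.

Lemma height1P M : is_prime M -> nonzero M ->
  (forall P, is_prime P -> nonzero P -> P `<=` M -> P = M) -> has_height M 1.
Proof.
move=> pM nM maxM; split.
  exists (fun i => if i is 0 then [set 0] else M).
  split=> //; first by case=> [|i] _ //; apply: prime_zero.
  case=> // _; split; first by move=> _ ->; case: pM => -[[]].
  by case: nM => x Mx /eqP x0 /(_ x Mx).
case=> [|[|m]] c [pc c_lt cM] //; exfalso.
have [_] := c_lt m.+1 (ltnSn _); rewrite cM; apply.
rewrite (maxM (c m.+1)) //; first exact: pc.
  have [_] := c_lt m (ltnW (ltnSn _)) => /existsNP[x /not_implyP[cx ncx]].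
  exists x => //; apply: contra_notN ncx => /eqP->.
  by have [[[]]] := pc m (ltnW (ltnW (ltnSn _))).
by rewrite -cM; have [] := c_lt m.+1 (ltnSn _).
Qed.

Lemma localization_pole M c u : is_prime M ->
  M c -> A (c * u) -> ~ M (c * u) -> ~ localization M u.
Proof.
move=> pM Mc Acu nMcu /(localizationP _ pM)[s [As nMs Asu]].
have [iM _ _] := pM.
have : M (s * (c * u)) by rewrite mulrCA; apply: ideal_mulr.
by case/(prime_mul pM As Acu).
Qed.

Definition infinitely_divisible M u : set K :=
  [set x | A x /\ forall n, localization M (x * u ^+ n)].

(** Think of [u] as [1/c] up to a unit at [M].  The elements of [R] divisible
at [M] by every power of [c] form an ideal strictly below [M], since it misses
[c]; if this ideal is prime, it must vanish when [M] has height one. *)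
Lemma height1_no_infinitely_divisible M c u :
    is_prime M -> has_height M 1 -> M c -> A (c * u) -> ~ M (c * u) ->
    (forall x y, A x -> A y -> infinitely_divisible M u (x * y) ->
      infinitely_divisible M u x \/ infinitely_divisible M u y) ->
  forall x, infinitely_divisible M u x -> x = 0.
Proof.
move=> pM hM Mc Acu nMcu Qmul x Qx; set Q := infinitely_divisible M u in Qmul Qx.
have nlu := localization_pole pM Mc Acu nMcu.
have [iM _ _] := pM.
apply: contrapT => /eqP x0.
have QM : Q `<=` M.
  move=> y [Ay ly]; apply: contrapT => nMy; apply: nlu.
  by apply: localization_cancel pM Ay nMy _; rewrite -[u]expr1; apply: ly.
have pQ : is_prime Q.
  have iQ : is_ideal Q.
    split=> [|y []//]; split.
    - split; first exact: base_ring0.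
      by move=> n; rewrite mul0r; apply/base_sub_localization/base_ring0.
    - move=> y z [Ay ly] [Az lz]; have [_ AD _] := submodule_base_ring R.
      split; first exact: AD.
      move=> n; have /(localizationP _ pM)[s [As nMs Asy]] := ly n.
      have /(localizationP _ pM)[t [At nMt Atz]] := lz n.
      apply/localizationP => //; exists (s * t).
      split; [exact: base_ringM|exact: prime_notin_mul|].
      have -> : s * t * ((y + z) * u ^+ n)
        = t * (s * (y * u ^+ n)) + s * (t * (z * u ^+ n)) by ring.
      by apply: AD; apply: base_ringM.
    - move=> r y [Ay ly]; split; first exact/base_ringM/Ay/base_ring_embed.
      move=> n; rewrite -mulrA; apply: localizationM => //.
      exact/base_sub_localization/base_ring_embed.
  split=> //.
    by apply/proper_idealP => // /QM; apply: prime_neq1.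
  by move=> a b; rewrite tofracM; apply: Qmul; apply: base_ring_embed.
have QE : Q = M by apply: height1_prime_eq => //; exists x.
have [_ /(_ 2)] : Q c by rewrite QE.
by rewrite expr2 mulrA; apply: contra_not nlu; apply: localization_cancel.
Qed.

(** * Invertibility at a prime *)

(** For a prime [P] this says that [S] generates a principal fractional ideal at
[P], with generator [g], because [s = g * (z * s) / (z * g)] for [s] in [S].
The multiplier [z] is kept because it also carries information at the other
primes. *)
Definition invertible_at P S : Prop :=
  exists g z, [/\ S g, idealV S z & ~ P (z * g)].

Lemma invertible_at_span P S : invertible_at P S -> invertible_at P (span S).
Proof.
move=> [g [z [Sg Vz nP]]]; exists g, z; rewrite idealV_span; split=> //.
exact: sub_span.
Qed.

(** A generator itself can be taken as the local generator: the products of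
[z] with the ideal generated by [S] lie in [M] once those with [S] do. *)
Lemma t_invertible_at S M : maximal_t_ideal M -> t_invertible (span S) ->
  invertible_at M S.
Proof.
move=> maxM tS; apply: contrapT => noinv.
have pM := maximal_t_ideal_prime maxM.
have [[sM _] _ _] := pM.
apply: (prime_neq1 pM); move: (base_ring1 R); rewrite -tS.
apply: t_closure_sub_maximal => //; first exact: submodule_span.
apply: span_min => // _ [a Sa [z + <-]]; rewrite idealV_span mulrC => Vz.
suff : span S `<=` [set b | M (z * b)] by apply.
have [M0 MD MM] := sM.
apply: span_min => [|b Sb]; first split=> /=.
- by rewrite mulr0.
- by move=> b b' Mb Mb'; rewrite mulrDr; apply: MD.
- by move=> r b Mb; rewrite mulrCA; apply: MM.
- by apply: contrapT => nMzb; apply: noinv; exists b, z.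
Qed.

Lemma t_invertible_local I : is_ideal I -> nonzero I ->
  (forall M, maximal_t_ideal M -> invertible_at M I) -> t_invertible I.
Proof.
move=> [sI IA] [x Ix x0] locI; apply: t_closure_full.
- split; first exact: submodule_span.
  apply: span_min; first exact: submodule_base_ring.
  by move=> _ [a Ia [z Vz <-]]; rewrite mulrC; apply: Vz.
- exists x => //; apply: sub_span; exists x => //; exists 1; last exact: mulr1.
  by move=> a /IA; rewrite mul1r.
- move=> M /locI[g [z [Ig Vz nMzg]]] IM; apply/nMzg/IM/sub_span.
  by exists g => //; exists z => //; rewrite mulrC.
Qed.

(** If [z] inverts [g] at [P], an element [x] of the v-closure satisfies
[x * (z * g) = (x * z) * g] with [x * z] in [R]. *)
Lemma invertible_at_v_closure P S : is_prime P -> S `<=` P ->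
  invertible_at P S -> v_closure S `<=` P.
Proof.
move=> pP SP [g [z [Sg Vz nP]]] x vx.
have [iP _ _] := pP; have [_ PA] := iP.
have Ax : A x by apply: v_closure_base vx => y /SP/PA.
have : P (x * (z * g)).
  by rewrite mulrA mulrC; apply: ideal_mulr iP (SP _ Sg) _; apply: vx.
by case/(prime_mul pP Ax (Vz _ Sg)).
Qed.

(** In a valuation domain one of the generators of a finitely generated ideal
divides the others; here [t] is a common denominator of the quotients. *)
Lemma essential_local_generator P (s : seq K) : essential_prime P ->
  exists g t, [/\ [set` 0 :: s] g, A t, ~ P t &
    forall x, x \in s -> exists2 r, A r & t * x = r * g].
Proof.
move=> [pP vP]; elim: s => [|x s [g [t [sg At nPt tg]]]].
  exists 0, 1; split=> //; first by rewrite /= inE.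
    exact: base_ring1.
  exact: prime_neq1.
have [->|x0] := eqVneq x 0.
  exists g, t; split=> //.
    by move: sg; rewrite /= !inE => /orP[]->; rewrite ?orbT.
  move=> y; rewrite inE => /predU1P[->|/tg//].
  by exists 0; rewrite ?mulr0 ?mul0r //; apply: base_ring0.
have keep_g : localization P (x / g) -> g != 0 ->
  exists g t, [/\ [set` 0 :: x :: s] g, A t, ~ P t &
    forall y, y \in x :: s -> exists2 r, A r & t * y = r * g].
  move=> /(localizationP _ pP)[q [Aq nPq Aqxg]] g0.
  exists g, (t * q); split.
  - by move: sg; rewrite /= !inE => /orP[]->; rewrite ?orbT.
  - exact: base_ringM.
  - exact: prime_notin_mul.
  - move=> y; rewrite inE => /predU1P[->|/tg[r Ar E]].
      exists (t * (q * (x / g))); first exact: base_ringM.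
      by rewrite -!mulrA mulVf // mulr1.
    by exists (q * r); [apply: base_ringM|rewrite mulrAC E mulrC mulrA].
have take_x : localization P (g / x) ->
  exists g t, [/\ [set` 0 :: x :: s] g, A t, ~ P t &
    forall y, y \in x :: s -> exists2 r, A r & t * y = r * g].
  move=> /(localizationP _ pP)[q [Aq nPq Aqgx]].
  exists x, (t * q); split.
  - by rewrite /= !inE eqxx orbT.
  - exact: base_ringM.
  - exact: prime_notin_mul.
  - move=> y; rewrite inE => /predU1P[->|/tg[r Ar E]].
      by exists (t * q) => //; apply: base_ringM.
    exists (r * (q * (g / x))); first exact: base_ringM.
    by rewrite -!mulrA mulVf // mulr1 mulrCA E mulrCA.
have [g0|g0] := eqVneq g 0.
  by apply: take_x; rewrite g0 mul0r; apply/base_sub_localization/base_ring0.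
have xg0 : x / g != 0 by rewrite mulf_neq0 ?invr_eq0.
by have [/keep_g|] := vP _ xg0; [apply|rewrite invf_div].
Qed.

Lemma essential_invertible_at P (s : seq K) : essential_prime P ->
  nonzero [set` s] -> invertible_at P [set` s].
Proof.
move=> eP [x sx x0].
have [g [t [sg At nPt tg]]] := essential_local_generator s eP.
have t0 := prime_notin_neq0 eP.1 nPt.
have g0 : g != 0.
  apply: contraNneq x0 => g0; have [r _] := tg x sx.
  by rewrite g0 mulr0 => /eqP; rewrite mulf_eq0 (negPf t0).
exists g, (t / g); split; last by rewrite divfK.
  by move: sg; rewrite /= inE (negPf g0).
by move=> y /tg[r Ar E]; rewrite mulrAC E mulfK.
Qed.

Lemma essential_prime_t_ideal P : essential_prime P -> nonzero P ->
  proper_t_ideal P.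
Proof.
move=> eP nP; have [[iP PA _] _] := eP; split=> //.
apply/t_idealP; split=> // s sP.
have [y Py y0] := nP; have yP := cons_sub Py sP.
apply: (@subset_trans _ (v_closure [set` y :: s])).
  by apply: v_closure_mono => x /= sx; rewrite inE sx orbT.
apply: invertible_at_v_closure yP _; first exact: eP.1.
by apply: essential_invertible_at => //; exists y; rewrite //= mem_head.
Qed.

Lemma defining_family_v_full F S : defining_family F -> S `<=` A ->
  (forall P, F P -> ~ S `<=` P) -> v_closure S 1.
Proof.
move=> [pF FA] SA noP y Vy; rewrite mul1r FA => P FP.
have pP := pF P FP.
have /existsNP[x /not_implyP[Sx nPx]] := noP P FP.
by apply/localizationP => //; exists x; rewrite mulrC; split; auto.
Qed.

End HeightOne.

(** * Generalized Krull domains are t-potent of t-dimension one *)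

Section Equivalences.
Variable R : idomainType.
Local Notation K := {fraction R}.
Local Notation A := (base_ring R).
Implicit Types (a c x y z u : K) (I J M N P S : set K) (F : set (set K)).

Lemma finite_avoidance F I : finite_set F -> (forall P, F P -> ~ I `<=` P) ->
  exists2 s : seq K, [set` s] `<=` I & forall P, F P -> ~ [set` s] `<=` P.
Proof.
move=> finF IF.
have [f fP] : exists f : set K -> K, forall P, F P -> I (f P) /\ ~ P (f P).
  suff /choice[f fP] : forall P, exists y, F P -> I y /\ ~ P y by exists f.
  move=> P; have [FP|nFP] := pselect (F P); last by exists 0.
  by have /existsNP[x /not_implyP] := IF P FP; exists x.
have /finite_seqP[s sE] := finite_image f finF.
exists s; rewrite -sE; first by move=> _ [P /fP[If _] <-].
by move=> P FP sP; have [_] := fP P FP; apply; apply: sP; exists P.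
Qed.

(** A nonzero element of [I], together with elements of [I] avoiding the
finitely many members of [F] that contain it, forms a finite family outside
every member of [F]: its v-closure is [R]. *)
Lemma proper_t_ideal_sub_family F I : defining_family F -> finite_character F ->
  proper_t_ideal I -> exists2 P, F P & I `<=` P.
Proof.
move=> dF fF [/t_idealP[iI [a Ia a0] tI] nIA]; apply: contrapT => noP.
have [_ IA] := iI; have [b _ ba] := IA _ Ia.
have [|P [FP _] IP|s sI sF] := finite_avoidance (fF b _) (I := I).
- by rewrite -tofrac_eq0 ba.
- by apply: noP; exists P.
have asI := cons_sub Ia sI.
have nI1 : ~ I 1 by apply/proper_idealP.
apply/nI1/(tI _ asI).
apply: defining_family_v_full dF _ _ => [x /asI/IA//|P FP asP].
apply: (sF P) => [|x sx]; last by apply: asP; rewrite /= inE sx orbT.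
by split=> //; rewrite ba; apply: asP; rewrite /= mem_head.
Qed.

Lemma has_height1_nonzero P : has_height P 1 -> nonzero P.
Proof.
move=> [[c [pc c_lt <-]] _].
have [_ /existsNP[x /not_implyP[cx ncx]]] := c_lt 0 isT.
exists x => //; apply: contra_notN ncx => /eqP->.
by have [[[]]] := pc 0 isT.
Qed.

Lemma generalized_Krull_maximal F : defining_family F -> finite_character F ->
    (forall P, F P -> has_height P 1 /\ essential_prime P) ->
  forall M, maximal_t_ideal M <-> F M.
Proof.
move=> dF fF hF M.
have F_t P : F P -> proper_t_ideal P.
  by case/hF=> /has_height1_nonzero nP eP; apply: essential_prime_t_ideal.
split=> [maxM|FM].
  have [P FP MP] := proper_t_ideal_sub_family dF fF maxM.1.
  by rewrite -(maxM.2 P (F_t P FP) MP).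
split; first exact: F_t.
move=> I ptI MI; have [P FP IP] := proper_t_ideal_sub_family dF fF ptI.
have MP : M = P.
  have [hM [pM _]] := hF M FM; have [hP [pP _]] := hF P FP.
  apply: (height1_prime_eq pP hP pM (has_height1_nonzero hM)).
  exact: subset_trans IP.
by apply/seteqP; split=> //; rewrite MP.
Qed.

Lemma generalized_Krull_t_potent_essential : generalized_Krull_domain R ->
  t_potent R /\ essential_domain R /\ t_dimension_one R.
Proof.
move=> [F [dF fF hF]]; have maxF := generalized_Krull_maximal dF fF hF.
split; [|split]; last by move=> M /maxF/hF[].
- move=> M maxM; have iM := maximal_t_ideal_ideal maxM.
  have [sM MA] := iM; have [a Ma a0] := maximal_t_ideal_nonzero maxM.
  have [b _ ba] := MA _ Ma.
  set F' := [set P | F P /\ P (embed b)] `&` [set P | P <> M].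
  have finF' : finite_set F'.
    apply: finite_setIl; apply: fF; first by rewrite -tofrac_eq0 ba.
  have [P [[FP _] PM] MP|s sM' sF'] := finite_avoidance finF' (I := M).
    by apply: PM; rewrite (maximal_t_ideal_inj maxM _ MP) //; apply/maxF.
  have asM := cons_sub Ma sM'.
  exists (span [set` a :: s]); last exact: span_min.
  split; last exists M.
  + split; first exact: submodule_span.
    by apply: span_min => [|x /asM/MA//]; apply: submodule_base_ring.
  + by exists a => //; apply: sub_span; rewrite /= mem_head.
  + by exists (a :: s).
  + split; first by split=> //; apply: span_min.
    move=> N [maxN asN]; apply: contrapT => MN; apply: (sF' N).
      split; last by move=> NM; apply: MN.
      split; first exact/maxF.
      by rewrite ba; apply/asN/sub_span; rewrite /= mem_head.
    by move=> x sx; apply/asN/sub_span; rewrite /= inE sx orbT.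
- by exists F; split=> // P /hF[].
Qed.

(** * From essential primes to t-invertibility *)

Lemma t_rigid_unique I M N : t_rigid I -> maximal_t_ideal M -> I `<=` M ->
  maximal_t_ideal N -> I `<=` N -> N = M.
Proof.
by move=> [_ _ _ [L [_ uL]]] maxM IM maxN IN; rewrite -(uL M) // -(uL N).
Qed.

(** The rigid ideal [I] inside [M] lies in some member [P] of the family,
otherwise its v-closure would be [R]; as [P] is a t-ideal, it lies in a maximal
t-ideal, which contains [I] and hence is [M].  Height one forces [P = M]. *)
Lemma t_potent_essential_maximal F M : t_potent R -> t_dimension_one R ->
  defining_family F -> F `<=` @essential_prime R -> maximal_t_ideal M ->
  essential_prime M.
Proof.
move=> tp dim1 dF eF maxM; have [I rI IM] := tp M maxM.
have [[sI IA] nI [s Is] _] := rI.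
have [[_ MA] _ _] := maximal_t_ideal_prime maxM.
have [P FP IP] : exists2 P, F P & I `<=` P.
  apply: contrapT => noP; apply: (prime_neq1 (maximal_t_ideal_prime maxM)).
  apply: (maximal_t_ideal_closed maxM (s := s)) => [x sx|].
    by apply: IM; rewrite Is; apply: sub_span.
  rewrite -v_closure_span -Is; apply: defining_family_v_full dF IA _.
  by move=> P FP IP; apply: noP; exists P.
have eP := eF P FP.
have nP : nonzero P by case: nI => x Ix x0; exists x => //; apply: IP.
have [N maxN PN] := t_ideal_sub_maximal (essential_prime_t_ideal eP nP).
have NM := t_rigid_unique rI maxM IM maxN (subset_trans IP PN).
rewrite NM in PN.
have pM := maximal_t_ideal_prime maxM.
by rewrite -(height1_prime_eq pM (dim1 M maxM) eP.1 nP PN).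
Qed.

Lemma t_potent_essential_PvMD :
  t_potent R /\ essential_domain R /\ t_dimension_one R ->
  t_potent R /\ PvMD R /\ t_dimension_one R.
Proof.
move=> [tp [[F [dF eF]] dim1]]; split=> //; split=> // I iI nI [s Is].
apply: t_invertible_local => // M maxM.
rewrite Is; apply: invertible_at_span; apply: essential_invertible_at.
  exact: t_potent_essential_maximal dF eF maxM.
have [x Ix x0] := nI; apply: contrapT => ns.
have : span [set` s] `<=` [set 0]; last first.
  by rewrite -Is => /(_ x Ix) /eqP; apply/negP.
apply: span_min; first by have [[]] := prime_zero R.
move=> y sy; apply/eqP; apply: contrapT => /negP y0; apply: ns.
by exists y.
Qed.

(** * Complete integral closure *)

(** The finitely generated ideal [(a, b)] is principal at [M], generated by [a]
or by [b]; so one of them divides the other. *)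
Lemma PvMD_maximal_essential M : PvMD R -> maximal_t_ideal M ->
  essential_prime M.
Proof.
move=> vR maxM; have pM := maximal_t_ideal_prime maxM; split=> // x x0.
have [a [s [s0 sx]]] := fraction_denom x.
set e := [:: embed a; embed s].
have eA : [set` e] `<=` A.
  by move=> y /=; rewrite !inE => /orP[]/eqP->; apply: base_ring_embed.
have te : t_invertible (span [set` e]).
  apply: vR; last by exists e.
    by split; [apply: submodule_span|apply: span_min (submodule_base_ring R) _].
  exists (embed s); last by rewrite tofrac_eq0.
  by apply: sub_span; rewrite /= !inE eqxx orbT.
have [g [z [eg Vz nM]]] := t_invertible_at maxM te.
have Aa : A (z * embed a) by apply: Vz; rewrite /= !inE eqxx.
have As : A (z * embed s) by apply: Vz; rewrite /= !inE eqxx orbT.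
move: eg nM; rewrite /= !inE => /orP[]/eqP-> nM; [right|left].
  apply/localizationP => //; exists (z * embed a); split=> //.
  by rewrite -sx -!mulrA mulfV // mulr1.
apply/localizationP => //; exists (z * embed s); split=> //.
by rewrite -mulrA sx.
Qed.

Lemma localizationV P x : is_prime P -> localization P x ->
  ~ localization P x^-1 -> exists c s, [/\ P c, A s, ~ P s & s * x = c].
Proof.
move=> pP /(localizationP _ pP)[s [As nPs Asx]] nV.
exists (s * x), s; split=> //; apply: contrapT => nPsx; apply: nV.
have sx0 := prime_notin_neq0 pP nPsx.
have x0 : x != 0 by apply: contraNneq sx0 => ->; rewrite mulr0.
by apply/localizationP => //; exists (s * x); rewrite mulfK.
Qed.

(** If [a * u ^+ n] lies in [R] for all [n] while [u] is not in the valuation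
ring [R_M], then [a] is divisible at [M] by all powers of the nonunit [u^-1].
The elements with this property form a prime ideal, which height one excludes. *)
Lemma PvMD_completely_integrally_closed : PvMD R -> t_dimension_one R ->
  completely_integrally_closed R.
Proof.
move=> vR dim1 a u a0 au; apply: base_ring_bigcap => M maxM.
have [pM vM] := PvMD_maximal_essential vR maxM.
apply: contrapT => nlu.
have u0 : u != 0.
  apply: contra_notN nlu => /eqP->.
  exact/base_sub_localization/base_ring0.
have [//|lV] := vM u u0.
have [|c [s [Mc As nMs sc]]] := localizationV pM lV; first by rewrite invrK.
have cu : c * u = s by rewrite -sc divfK.
suff /eqP : embed a = 0 by rewrite tofrac_eq0; apply/negP.
apply: (@height1_no_infinitely_divisible _ M c u); rewrite ?cu //.
- exact: dim1.
- move=> x y Ax Ay [Axy lxy]; apply: contrapT => /not_orP[nQx nQy].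
  have /existsNP[n nx] : ~ forall n, localization M (x * u ^+ n).
    by move=> lx; apply: nQx.
  have /existsNP[m ny] : ~ forall n, localization M (y * u ^+ n).
    by move=> ly; apply: nQy.
  have xu0 : x * u ^+ n != 0.
    by apply: contra_notN nx => /eqP->; apply/base_sub_localization/base_ring0.
  have [//|lxV] := vM _ xu0; apply: ny.
  have -> : y * u ^+ m = x * y * u ^+ (n + m) * (x * u ^+ n)^-1.
    have -> : x * y * u ^+ (n + m) = (x * u ^+ n) * (y * u ^+ m).
      by rewrite exprD mulrACA.
    by rewrite mulrAC mulfV // mul1r.
  exact: localizationM.
- split; first exact: base_ring_embed.
  case=> [|n]; last by apply/base_sub_localization/au.
  by rewrite mulr1; apply/base_sub_localization/base_ring_embed.
Qed.

Lemma PvMD_t_super_potent : t_potent R -> PvMD R -> t_super_potent R.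
Proof.
move=> tp vR M maxM; have [I rI IM] := tp M maxM.
exists I => //; split=> // J iJ fJ IJ; apply: vR => //.
by have [_ [x Ix x0] _ _] := rI; exists x => //; apply: IJ.
Qed.

End Equivalences.

(** * Local structure at a t-super rigid ideal *)

Section SuperRigid.
Variable R : idomainType.
Local Notation K := {fraction R}.
Local Notation A := (base_ring R).
Implicit Types (x y w : K) (J N P S : set K).

Variables (I M : set K).
Hypothesis superI : t_super_rigid I.
Hypothesis maxM : maximal_t_ideal M.
Hypothesis IM : I `<=` M.

Let pM : is_prime M := maximal_t_ideal_prime maxM.

Let idealI : is_ideal I.
Proof. by case: superI => -[]. Qed.

Let idealM : is_ideal M.
Proof. by case: pM. Qed.

Lemma super_rigid_invertible_at (e : seq K) : [set` e] `<=` A ->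
  invertible_at M (I `|` [set` e]).
Proof.
move=> eA; have [[_ _ [s Is] _] invI] := superI.
have [sI IA] := idealI.
have sIs : [set` s] `<=` I by rewrite Is; apply: sub_span.
have [|g [z [sg Vz nM]]] := @t_invertible_at _ [set` s ++ e] M maxM.
  apply: invI; last by rewrite Is; apply: span_mono => x /= sx; rewrite mem_cat sx.
    split; first exact: submodule_span.
    apply: span_min; first exact: submodule_base_ring.
    by move=> x; rewrite /= mem_cat => /orP[/sIs/IA|/eA].
  by exists (s ++ e).
exists g, z; split=> //.
  by move: sg; rewrite /= mem_cat => /orP[/sIs|]; [left|right].
move=> x [Ix|ex]; last by apply: Vz; rewrite /= mem_cat ex orbT.
have : idealV (span [set` s]) z.
  by rewrite idealV_span => y sy; apply: Vz; rewrite /= mem_cat sy.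
by rewrite -Is; apply.
Qed.

Lemma super_rigid_adjoin y : M y ->
  exists J, [/\ t_super_rigid J, J `<=` M & J y].
Proof.
move=> My; have [[_ nI [s Is] _] invI] := superI.
have sIs : [set` s] `<=` I by rewrite Is; apply: sub_span.
set J := span [set` y :: s]; have [sM MA] := idealM.
have JM : J `<=` M by apply: span_min => //; apply: cons_sub => // x /sIs/IM.
have IJ : I `<=` J.
  by rewrite Is; apply: span_mono => x /= sx; rewrite inE sx orbT.
exists J; split=> //; last by apply: sub_span; rewrite /= mem_head.
split; last by move=> L iL fL JL; apply: invI => //; apply: subset_trans JL.
split.
- by split=> [|x /JM/MA //]; apply: submodule_span.
- by case: nI => x Ix x0; exists x => //; apply: IJ.
- by exists (y :: s).
- exists M; split=> // N [maxN JN]; apply/esym.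
  by apply: (t_rigid_unique superI.1) => //; apply: subset_trans JN.
Qed.

Lemma super_rigid_inverse_away N w : maximal_t_ideal N -> N <> M ->
  idealV I w -> localization N w.
Proof.
move=> maxN NM Vw; have [_ IA] := idealI.
have /existsNP[x /not_implyP[Ix nNx]] : ~ I `<=` N.
  by move=> IN; apply: NM; apply: (t_rigid_unique superI.1).
apply/localizationP; first exact: maximal_t_ideal_prime.
by exists x; split; [apply: IA| |rewrite mulrC; apply: Vw].
Qed.

(** From here on [c] generates [I] at [M], with local inverse [z]: dividing by
[c] at [M] is multiplying by [z], with the advantage that multiplication by
[z] preserves integrality at all the other maximal t-ideals. *)
Variables (c z : K).
Hypothesis Ic : I c.
Hypothesis Vz : idealV I z.
Hypothesis nMzc : ~ M (z * c).

Let Azc : A (z * c) := Vz Ic.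

Let Ac : A c.
Proof. by case: idealI => _; apply. Qed.

Lemma super_rigid_pole : ~ localization M z.
Proof.
by apply: (@localization_pole _ M c) => //; [apply: IM|rewrite mulrC..].
Qed.

(** Divide [x] at [M] by the largest possible power of [c].  The quotient is not
divisible by [c] at [M], and is called reduced; it lies in [R] because [z] is
integral at all other maximal t-ideals. *)
Lemma super_rigid_reduced x : A x -> ~ infinitely_divisible M z x ->
  exists i, A (x * z ^+ i) /\ ~ localization M (z * (x * z ^+ i)).
Proof.
move=> Ax nQx; have /existsNP[n nl] : ~ forall n, localization M (x * z ^+ n).
  by move=> lx; apply: nQx.
have [i [li nli]] : exists i,
    localization M (x * z ^+ i) /\ ~ localization M (x * z ^+ i.+1).
  elim: n nl => [|n IHn] nl.
    by case: nl; rewrite mulr1; apply: base_sub_localization.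
  by have [l|/IHn] := pselect (localization M (x * z ^+ n)); first by exists n.
exists i; split; last by rewrite mulrCA -exprS.
apply: base_ring_bigcap => N maxN; have pN := maximal_t_ideal_prime maxN.
have [->//|NM] := pselect (N = M).
apply: localizationM => //; first exact: base_sub_localization.
by apply: localizationX => //; apply: super_rigid_inverse_away.
Qed.

(** The ideal generated by [I] and [e] is principal at [M]; when some member of
[e] is not divisible by [c] at [M], the generator cannot come from [I], all
members of which are. *)
Lemma super_rigid_generator (e : seq K) y : [set` e] `<=` A ->
  y \in e -> ~ localization M (z * y) ->
  exists g w, [/\ g \in e, idealV (I `|` [set` e]) w & ~ M (w * g)].
Proof.
move=> eA ey nlzy; have [g [w [Jg Vw nMwg]]] := super_rigid_invertible_at eA.
exists g, w; split=> //; case: Jg => // Ig; case: nlzy.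
have Awg : A (w * g) by apply: Vw; left.
apply/localizationP => //; exists (w * g); split=> //.
have -> : w * g * (z * y) = (z * g) * (w * y) by ring.
by apply: base_ringM; [apply: Vz|apply: Vw; right].
Qed.

Lemma super_rigid_reduced_unit x : A x -> ~ localization M (z * x) ->
  exists w, [/\ idealV I w, A (w * x) & ~ M (w * x)].
Proof.
move=> Ax nl; have xA : [set` [:: x]] `<=` A by move=> y; rewrite /= inE => /eqP->.
have [|g [w [+ Vw]]] := super_rigid_generator xA _ nl; first by rewrite inE.
rewrite inE => /eqP-> nM; exists w; split=> //.
  by move=> y Iy; apply: Vw; left.
by apply: Vw; right; rewrite /= inE.
Qed.

(** Reduced elements divide [c] at [M], so a product of two of them divides
[c ^+ 2] and cannot be divisible by [c ^+ 3]. *)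
Lemma super_rigid_infinitely_divisible_prime :
  forall x y, A x -> A y -> infinitely_divisible M z (x * y) ->
    infinitely_divisible M z x \/ infinitely_divisible M z y.
Proof.
move=> x y Ax Ay [_ lxy]; apply: contrapT => /not_orP[nQx nQy].
have [i [Axi nlx]] := super_rigid_reduced Ax nQx.
have [j [Ayj nly]] := super_rigid_reduced Ay nQy.
have [v [Vv Av nMv]] := super_rigid_reduced_unit Axi nlx.
have [w [Vw Aw nMw]] := super_rigid_reduced_unit Ayj nly.
apply: super_rigid_pole.
set p := v * (x * z ^+ i); set q := w * (y * z ^+ j).
apply: (@localization_cancel _ _ _ ((z * c) * (z * c) * (p * q))) => //.
- by do ![assumption | apply: base_ringM].
- by do ![assumption | apply: base_ringM | apply: prime_notin_mul].
- have -> : (z * c) * (z * c) * (p * q) * z =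
      (v * c) * (w * c) * (x * y * z ^+ (i + j + 3)).
    rewrite /p /q exprD exprD; ring.
  apply: localizationM => //; apply: base_sub_localization => //.
  by apply: base_ringM; [apply: Vv|apply: Vw].
Qed.

(** Here complete integral closure enters: an element divisible at [M] by all
powers of [c] is a common denominator for all powers of [z]. *)
Lemma completely_integrally_closed_no_infinitely_divisible x :
  completely_integrally_closed R -> infinitely_divisible M z x -> x = 0.
Proof.
move=> cic [[a _ <-] lx]; have [->|a0] := eqVneq a 0; first exact: tofrac0.
case: super_rigid_pole; apply: base_sub_localization => //.
apply: cic a0 _ => n _; apply: base_ring_bigcap => N maxN.
have pN := maximal_t_ideal_prime maxN.
have [->//|NM] := pselect (N = M).
apply: localizationM => //; first exact/base_sub_localization/base_ring_embed.
by apply: localizationX => //; apply: super_rigid_inverse_away.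
Qed.

Hypothesis no_inf : forall x, infinitely_divisible M z x -> x = 0.

Lemma super_rigid_reduced_nonzero x : A x -> x != 0 ->
  exists i, A (x * z ^+ i) /\ ~ localization M (z * (x * z ^+ i)).
Proof.
by move=> Ax /eqP x0; apply: super_rigid_reduced => // /no_inf.
Qed.

(** Let [x] be a nonzero element of [P], divisible by [c ^+ i] and no more at
[M]; as the quotient divides [c], the ideal [P] contains [y ^+ i.+1], up to an
element outside [M], for all [y] in [I]. *)
Lemma super_rigid_sub_prime P : is_prime P -> nonzero P -> P `<=` M -> I `<=` P.
Proof.
move=> pP [x Px x0] PM y Iy.
have [iP _ _] := pP; have [_ PA] := iP; have [_ IA] := idealI.
have [i [Ax nlx]] := super_rigid_reduced_nonzero (PA _ Px) x0.
have [w [Vw Aw nMw]] := super_rigid_reduced_unit Ax nlx.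
have : P (y ^+ i.+1 * (w * (x * z ^+ i))).
  have -> : y ^+ i.+1 * (w * (x * z ^+ i)) = x * ((w * y) * (z * y) ^+ i).
    rewrite exprMn exprS; ring.
  apply: ideal_mulr => //; apply: base_ringM; first exact: Vw.
  by apply: base_ringX; apply: Vz.
have Ay : A y := IA _ Iy.
case/(prime_mul pP (base_ringX _ Ay) Aw) => [|/PM//].
exact: prime_exp.
Qed.

(** If [x] and [y] reduce after the same number of steps, their reduced forms
are compared by means of the ideal they generate together with [I]; otherwise
the reduced form of one divides [c], which still divides the partial reduction
of the other. *)
Lemma super_rigid_comparable x y : A x -> A y -> x != 0 -> y != 0 ->
  exists w, [/\ A (w * x), A (w * y) & ~ M (w * x) \/ ~ M (w * y)].
Proof.
move=> Ax Ay x0 y0.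
have [i [Axi nlx]] := super_rigid_reduced_nonzero Ax x0.
have [j [Ayj nly]] := super_rigid_reduced_nonzero Ay y0.
wlog ij : x y i j {x0 y0} Ax Ay Axi nlx Ayj nly / (i <= j)%N => [hw|].
  have [ij|/ltnW ji] := leqP i j; first exact: (hw x y i j).
  have [w [Awy Awx nM]] := hw y x j i Ay Ax Ayj nly Axi nlx ji.
  by exists w; split=> //; case: nM; [right|left].
move: ij; rewrite leq_eqVlt => /predU1P[Eij|ij].
  rewrite -Eij in Ayj nly.
  set e := [:: x * z ^+ i; y * z ^+ i].
  have eA : [set` e] `<=` A by move=> u; rewrite /= !inE => /orP[]/eqP->.
  have [|g [w [eg Vw nM]]] := super_rigid_generator eA _ nlx.
    by rewrite !inE eqxx.
  have wz u : w * z ^+ i * u = w * (u * z ^+ i) by rewrite -mulrA [_ * u]mulrC.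
  exists (w * z ^+ i); rewrite !wz; split.
  - by apply: Vw; right; rewrite /= !inE eqxx.
  - by apply: Vw; right; rewrite /= !inE eqxx orbT.
  - by move: eg nM; rewrite !inE => /orP[]/eqP->; [left|right].
have [w [Vw Aw nMw]] := super_rigid_reduced_unit Axi nlx.
have [d dE] : exists d, j = (i + d.+1)%N.
  by exists (j - i.+1)%N; rewrite addnS -addSn subnKC.
(* [z ^+ i] brings [x] to its reduced form, which [w] makes a unit at [M]; the
   remaining powers of [z] needed by [y] are paid for by powers of [c]. *)
exists (w * z ^+ i * (z * c) ^+ d.+1).
have -> : w * z ^+ i * (z * c) ^+ d.+1 * x = w * (x * z ^+ i) * (z * c) ^+ d.+1.
  by ring.
have -> : w * z ^+ i * (z * c) ^+ d.+1 * y = (w * c) * c ^+ d * (y * z ^+ j).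
  rewrite dE exprMn exprD [c ^+ d.+1]exprS; ring.
have Azcd := base_ringX d.+1 Azc.
split; first exact: base_ringM.
  by apply: base_ringM => //; apply: base_ringM; [apply: Vw|apply: base_ringX].
by left; apply: prime_notin_mul => // /(prime_exp pM Azc).
Qed.

Lemma super_rigid_essential : essential_prime M.
Proof.
split=> // x x0; have [a [s [s0 sx]]] := fraction_denom x.
have s0' : embed s != 0 by rewrite tofrac_eq0.
have a0' : embed a != 0 by rewrite -sx mulf_neq0.
have [w [Aa As [nMa|nMs]]] := super_rigid_comparable
  (base_ring_embed a) (base_ring_embed s) a0' s0'; [right|left].
  apply/localizationP => //; exists (w * embed a); split=> //.
  by rewrite -sx -!mulrA mulfV // mulr1.
apply/localizationP => //; exists (w * embed s); split=> //.
by rewrite -mulrA sx.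
Qed.

(** With [x * z ^+ i] reduced and [w] its inverse at [M], the element
[x * z ^+ i * w] works: [z] and [w] are integral away from [M]. *)
Lemma super_rigid_separating x : A x -> x != 0 ->
  exists b, [/\ A b, ~ M b &
    forall N, maximal_t_ideal N -> N <> M -> N x -> N b].
Proof.
move=> Ax x0; have [i [Axi nlx]] := super_rigid_reduced_nonzero Ax x0.
have [w [Vw Aw nMw]] := super_rigid_reduced_unit Axi nlx.
exists (w * (x * z ^+ i)); split=> // N maxN NM Nx.
have pN := maximal_t_ideal_prime maxN.
have /(localizationP _ pN)[s [As nNs Aswz]] : localization N (w * z ^+ i).
  apply: localizationM => //; first exact: super_rigid_inverse_away.
  by apply: localizationX => //; apply: super_rigid_inverse_away.
have : N (s * (w * (x * z ^+ i))).
  have -> : s * (w * (x * z ^+ i)) = x * (s * (w * z ^+ i)) by ring.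
  by apply: ideal_mulr => //; case: pN.
by case/(prime_mul pN As Aw).
Qed.

End SuperRigid.

(** * Consequences of t-super potency *)

Section FromSuperPotent.
Variable R : idomainType.
Local Notation K := {fraction R}.
Local Notation A := (base_ring R).
Implicit Types (x y w : K) (I J M N P S : set K).

Lemma super_rigid_inverse I M : t_super_rigid I -> maximal_t_ideal M ->
  I `<=` M -> exists c z, [/\ I c, idealV I z & ~ M (z * c)].
Proof.
move=> sI maxM IM.
have [//|c [z [Jc Vz nM]]] := super_rigid_invertible_at sI maxM (e := [::]).
by exists c, z; split=> // [|x Ix]; [case: Jc|apply: Vz; left].
Qed.

(** Any [y] in [M] can be adjoined to a super rigid ideal inside [M], so it is
enough that nonzero primes inside [M] contain every such ideal. *)
Lemma completely_integrally_closed_t_dimension_one :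
  completely_integrally_closed R -> t_super_potent R -> t_dimension_one R.
Proof.
move=> cic tsp M maxM.
apply: height1P (maximal_t_ideal_prime maxM) (maximal_t_ideal_nonzero maxM) _.
move=> P pP nP PM; apply/seteqP; split=> // y My.
have [I sI IM] := tsp M maxM.
have [J [sJ JM Jy]] := super_rigid_adjoin sI maxM IM My.
have [c [z [Jc Vz nM]]] := super_rigid_inverse sJ maxM JM.
apply: (super_rigid_sub_prime sJ maxM JM Vz _ pP nP PM) => // x.
exact: (completely_integrally_closed_no_infinitely_divisible
  sJ maxM JM Jc Vz nM).
Qed.

Lemma t_dimension_one_inverse M : t_super_potent R -> t_dimension_one R ->
  maximal_t_ideal M ->
  exists I c z, [/\ t_super_rigid I, I `<=` M, I c, idealV I z & ~ M (z * c)] /\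
    forall x, infinitely_divisible M z x -> x = 0.
Proof.
move=> tsp dim1 maxM; have [I sI IM] := tsp M maxM.
have [c [z [Ic Vz nM]]] := super_rigid_inverse sI maxM IM.
exists I, c, z; split=> // x.
apply: (@height1_no_infinitely_divisible _ M c z); rewrite ?(mulrC c) //.
- exact: maximal_t_ideal_prime.
- exact: dim1.
- exact: IM.
- exact: Vz.
- exact (super_rigid_infinitely_divisible_prime sI maxM IM Ic Vz nM).
Qed.

(** Each maximal t-ideal [M] containing [a] has an element [b] outside [M]
which lies in all the other maximal t-ideals containing [a].  The ideal
generated by [a] and these elements lies in no maximal t-ideal, so that already
finitely many of them generate an ideal whose v-closure is [R]; then only the
corresponding finitely many [M] can contain [a]. *)
Lemma maximal_t_ideals_finite_character :
  t_super_potent R -> t_dimension_one R -> finite_character (@maximal_t_ideal R).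
Proof.
move=> tsp dim1 r r0; set a := embed r.
have a0 : a != 0 by rewrite tofrac_eq0.
have Aa : A a := base_ring_embed r.
set T := [set M | _].
set S := a |` [set b | A b /\ exists2 M, T M & ~ M b /\
  forall N, T N -> N <> M -> N b].
have SA : S `<=` A by move=> b [->//|[]].
have iS : is_ideal (span S).
  by split; [apply: submodule_span|apply: span_min (submodule_base_ring R) SA].
have nS : nonzero (span S) by exists a => //; apply/sub_span; left.
have tS : t_closure (span S) = A.
  apply: t_closure_full => // M maxM SM.
  have Ma : M a by apply/SM/sub_span; left.
  have [I [c [z [[sI IM Ic Vz nM] no_inf]]]] :=
    t_dimension_one_inverse tsp dim1 maxM.
  have [b [Ab nMb bN]] :=
    super_rigid_separating sI maxM IM Vz no_inf Aa a0.
  apply/nMb/SM/sub_span; right; split=> //; exists M => //; split=> //.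
  by move=> N [maxN Na] NM; apply: bN.
have : t_closure (span S) 1 by rewrite tS; apply: base_ring1.
move/(t_closureP _ iS.1 nS) => [t tS1 vt].
have [x|s sS ts] := gather_finite (S := S) (@span_mono R) _ tS1.
  exact: span_finite_support.
have vs : v_closure [set` s] 1.
  by rewrite -v_closure_span; apply: v_closure_mono vt.
have s_avoids M : T M -> exists2 b, b \in s & ~ M b.
  move=> [maxM Ma]; apply: contrapT => noB.
  apply: (prime_neq1 (maximal_t_ideal_prime maxM)).
  apply: (maximal_t_ideal_closed maxM _ vs) => b sb.
  by apply: contrapT => nMb; apply: noB; exists b.
(* [owner b] is the only maximal t-ideal containing [a] but not [b] *)
pose owner b := xget set0 [set M | T M /\ ~ M b].
apply: (@sub_finite_set _ _ [set owner b | b in [set` s]]).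
  move=> M TM; have [b sb nMb] := s_avoids M TM.
  exists b => //; have [TL nLb] : T (owner b) /\ ~ owner b b.
    by apply: (@xgetPex _ set0 [set L | T L /\ ~ L b]); exists M.
  have [ba|[_ [N TN [nNb bN]]]] := sS b sb.
    by case: nMb; rewrite ba; case: TM.
  have ownerN L : T L -> ~ L b -> L = N.
    by move=> TL' nLb'; apply: contrapT => /(bN _ TL').
  by rewrite (ownerN _ TL nLb) (ownerN _ TM nMb).
exact/finite_image/finite_seq.
Qed.

Lemma t_super_potent_generalized_Krull :
  t_super_potent R -> t_dimension_one R -> generalized_Krull_domain R.
Proof.
move=> tsp dim1; exists (@maximal_t_ideal R); split.
- split=> [M|]; first exact: maximal_t_ideal_prime.
  apply/seteqP; split=> [x Ax M maxM|x lx]; last exact: base_ring_bigcap.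
  by apply: base_sub_localization => //; apply: maximal_t_ideal_prime.
- exact: maximal_t_ideals_finite_character.
- move=> M maxM; split; first exact: (dim1 M maxM).
  have [I [c [z [[sI IM Ic Vz nM] no_inf]]]] :=
    t_dimension_one_inverse tsp dim1 maxM.
  exact (super_rigid_essential sI maxM IM Ic Vz nM no_inf).
Qed.

End FromSuperPotent.

Theorem theorem5p9 (R : idomainType) :
  [<-> generalized_Krull_domain R;
       t_potent R /\ essential_domain R /\ t_dimension_one R;
       t_potent R /\ PvMD R /\ t_dimension_one R;
       completely_integrally_closed R /\ t_super_potent R;
       t_super_potent R /\ t_dimension_one R].
Proof.
split; first exact: generalized_Krull_t_potent_essential.
split; first exact: t_potent_essential_PvMD.
split.
  move=> [tp [vR dim1]]; split; first exact: PvMD_completely_integrally_closed.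
  exact: PvMD_t_super_potent.
split.
  move=> [cic tsp]; split=> //.
  exact: completely_integrally_closed_t_dimension_one.
by move=> [tsp dim1]; apply: t_super_potent_generalized_Krull.
Qed.
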